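(* An entailment relation $\models^\mathcal{D}_\mathsf{biG}$ is validity-stable iff there is a point-generated filter $\mathcal{D}'$ s.t.\ $\mathcal{D}\subseteq\mathcal{D}'$.
   Context: Bi-Gödel logic $\mathsf{biG}$: formulas are built from propositional variables and the constants $\mathbf{0},\mathbf{1}$ with ${\sim},\triangle,\wedge,\vee,\rightarrow$ and the co-implication $-\!<$. A $\mathsf{biG}$-valuation $v$ maps variables to $[0,1]$ and is extended by $v(\mathbf{0})=0$, $v(\mathbf{1})=1$, $v(\phi\wedge\chi)=\min$, $v(\phi\vee\chi)=\max$, $v(\phi\rightarrow\chi)=1$ if $v(\phi)\leq v(\chi)$ and $v(\chi)$ otherwise, $v(\phi-\!<\chi)=0$ if $v(\phi)\leq v(\chi)$ and $v(\phi)$ otherwise, $v({\sim}\phi)=1$ if $v(\phi)=0$ and $0$ otherwise, $v(\triangle\phi)=1$ if $v(\phi)=1$ and $0$ otherwise. $\phi$ is $\mathsf{biG}$-valid iff $v(\phi)=1$ for every $v$. A filter on $[0,1]$ is a non-empty proper subset $\mathcal{D}\subsetneq[0,1]$ closed under $\min$ and upward closed. For a filter $\mathcal{D}$, $\Gamma\models^\mathcal{D}_\mathsf{biG}\chi$ iff for every valuation $v$, $\inf\{v(\phi)\mid\phi\in\Gamma\}\in\mathcal{D}$ implies $v(\chi)\in\mathcal{D}$. $\models^\mathcal{D}_\mathsf{biG}$ (and $\mathcal{D}$) is validity-stable iff: $v(\phi)\in\mathcal{D}$ for every valuation $v$ iff $\phi$ is $\mathsf{biG}$-valid. A filter is point-generated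 if it is of the form $[d,1]$ with $d>0$. *)

(* Defs.v *)
From HB Require Import structures.
From mathcomp Require Import all_boot all_order all_algebra.
From mathcomp Require Import all_classical all_reals all_analysis.

Set Implicit Arguments.
Unset Strict Implicit.
Unset Printing Implicit Defensive.

Import Order.TTheory GRing.Theory Num.Theory.

Local Open Scope classical_set_scope.
Local Open Scope ring_scope.

Inductive form : Type :=
| Var of nat
| Zero
| One
| Neg of form
| Delta of form
| And of form & form
| Or of form & form
| Imp of form & form
| Coimp of form & form.

Definition valuation (R : realType) (v : nat -> R) : Prop :=
  forall p : nat, `[0, 1]%classic (v p).

Fixpoint eval (R : realType) (v : nat -> R) (f : form) : R :=
  match f with
  | Var p => v p
  | Zero => 0
  | One => 1
  | Neg a => if eval v a == 0 then 1 else 0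
  | Delta a => if eval v a == 1 then 1 else 0
  | And a b => Num.min (eval v a) (eval v b)
  | Or a b => Num.max (eval v a) (eval v b)
  | Imp a b => if eval v a <= eval v b then 1 else eval v b
  | Coimp a b => if eval v a <= eval v b then 0 else eval v a
  end.

Definition biG_valid (R : realType) (f : form) : Prop :=
  forall v : nat -> R, valuation v -> eval v f = 1.

Definition is_filter (R : realType) (D : set R) : Prop :=
  [/\ D !=set0,
      D `<` `[0, 1]%classic,
      forall x y : R, D x -> D y -> D (Num.min x y)
    & forall x y : R, D x -> x <= y -> y <= 1 -> D y].

Definition point_generated (R : realType) (D : set R) : Prop :=
  is_filter D /\ exists d : R, 0 < d /\ D = `[d, 1]%classic.

(* The infimum is taken in the lattice [0,1], where the infimum of the empty
   set is 1.  The library's [inf set0] is 0; adjoining 1 corrects this and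
   leaves the infimum of a non-empty subset of [0,1] unchanged. *)
Definition entails (R : realType) (D : set R) (G : set form) (f : form) : Prop :=
  forall v : nat -> R, valuation v ->
    D (inf ([set 1] `|` [set eval v g | g in G])) -> D (eval v f).

(* Validity-stability of the relation [entails D] is by definition a condition
   on [D]; [entails0P] rewrites it in terms of the relation. *)
Definition validity_stable (R : realType) (D : set R) : Prop :=
  forall f : form,
    (forall v : nat -> R, valuation v -> D (eval v f)) <-> biG_valid R f.

Lemma entails0P (R : realType) (D : set R) (f : form) : is_filter D ->
  entails D set0 f <-> (forall v : nat -> R, valuation v -> D (eval v f)).
Proof.
case=> -[x Dx] [sD _] _ up.
have D1 : D 1.
  by have /= := sD _ Dx; rewrite in_itv /= => /andP[_ x1]; apply: up Dx x1 _.
split=> [H v vv|H v vv _]; last exact: H.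
by apply: H => //; rewrite image_set0 setU0 inf1.
Qed.

(* Main.v *)
Require Import Defs.
From mathcomp Require Import all_boot all_order all_algebra.
From mathcomp Require Import all_classical all_reals all_analysis.
From mathcomp Require Import lra.

Import Order.TTheory GRing.Theory Num.Theory.

Local Open Scope classical_set_scope.
Local Open Scope ring_scope.

(* Strictly increasing self-maps of [0,1] fixing the endpoints commute with
   evaluation. Multiplying every value below 1 by a small e > 0 is such a map,
   so a non-valid formula takes arbitrarily small values and every filter
   bounded away from 0 is validity-stable. The only filter not contained in
   some [d,1] with d > 0 is (0,1], which is refuted by excluded middle:
   p \/ ~p is always positive but takes the value 1/2. *)

Lemma eval_itv (R : realType) (v : nat -> R) (f : Defs.form) :
  valuation v -> 0 <= Defs.eval v f <= 1.
Proof.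
move=> vv.
elim: f => [p||| a _ | a _ | a IHa b IHb | a IHa b IHb | a IHa b IHb
  | a IHa b IHb] /=.
- by have := vv p; rewrite /= in_itv.
- by rewrite lexx ler01.
- by rewrite ler01 lexx.
- by case: ifP => _; rewrite ?lexx ler01 ?lexx.
- by case: ifP => _; rewrite ?lexx ler01 ?lexx.
- by rewrite /Num.min; case: ifP.
- by rewrite /Num.max; case: ifP.
- by case: ifP => _ //; rewrite ler01 lexx.
- by case: ifP => _ //; rewrite ler01 lexx.
Qed.

(** Each connective returns an endpoint or one of its arguments, selected by comparing arguments
    with each other or with an endpoint. A map that fixes the endpoints and reflects and preserves
    order on [0,1] leaves every selection unchanged. *)
Lemma eval_comp (R : realType) (h : R -> R) (v : nat -> R) (f : Defs.form) :
  h 0 = 0 -> h 1 = 1 ->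
  {in `[0, 1] &, {mono h : x y / x <= y}} -> valuation v ->
  Defs.eval (h \o v) f = h (Defs.eval v f).
Proof.
move=> h0 h1 hle vv.
have ev g : Defs.eval v g \in `[0, 1] by rewrite in_itv; exact: eval_itv.
have m0 : (0 : R) \in `[0, 1] by rewrite in_itv /= lexx ler01.
have m1 : (1 : R) \in `[0, 1] by rewrite in_itv /= lexx ler01.
have heq x y : x \in `[0, 1] -> y \in `[0, 1] -> (h x == h y) = (x == y).
  by move=> xI yI; rewrite !eq_le !hle.
have hlt x y : x \in `[0, 1] -> y \in `[0, 1] -> (h x < h y) = (x < y).
  by move=> xI yI; rewrite !lt_neqAle heq ?hle.
elim: f => [p||| a IHa | a IHa | a IHa b IHb | a IHa b IHb | a IHa b IHb
  | a IHa b IHb] //=.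
- by rewrite IHa -{1}h0 heq //; case: ifP.
- by rewrite IHa -{1}h1 heq //; case: ifP.
- by rewrite IHa IHb /Num.min hlt //; case: ifP.
- by rewrite IHa IHb /Num.max hlt //; case: ifP.
- by rewrite IHa IHb hle //; case: ifP.
- by rewrite IHa IHb hle //; case: ifP.
Qed.

Definition squeeze {R : realType} (e t : R) : R := if t == 1 then 1 else t * e.

(** Monotonicity is confined to [0,1]: arguments just above 1 are sent below 1. *)
Lemma squeeze_mono (R : realType) (e : R) : 0 < e < 1 ->
  {in `[0, 1] &, {mono squeeze e : x y / x <= y}}.
Proof.
move=> /andP[e0 e1] x y; rewrite !in_itv /= => /andP[x0 x1] /andP[y0 y1].
rewrite /squeeze; case: (eqVneq x 1) => [->|xn1]; case: (eqVneq y 1) => [->|yn1].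
- by rewrite !lexx.
- have y1' : y < 1 by rewrite lt_neqAle yn1.
  by rewrite !leNgt y1'; apply/negbTE; rewrite negbK; nra.
- by rewrite x1; nra.
- by rewrite ler_pM2r.
Qed.

Lemma filter1 (R : realType) (D : set R) : is_filter D -> D 1.
Proof.
case=> -[x Dx] [sD _] _ up.
by have /= := sD _ Dx; rewrite in_itv /= => /andP[_ x1]; exact: up Dx x1 _.
Qed.

Lemma point_generated_itv (R : realType) (d : R) : 0 < d -> d <= 1 ->
  point_generated `[d, 1]%classic.
Proof.
move=> d0 d1; split; last by exists d.
split.
- by exists 1; rewrite /= in_itv /= d1 lexx.
(* Properness is witnessed by 0, which [0 < d] keeps out of [d,1]. *)
- split=> [x|/(_ 0)] /=; rewrite !in_itv /=.
    by move=> /andP[dx ->]; rewrite andbT (le_trans (ltW d0)).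
  by rewrite lexx ler01 leNgt d0 => /(_ isT).
- by move=> x y; rewrite /Num.min; case: ifP.
- move=> x y /=; rewrite !in_itv /= => /andP[dx _] xy ->.
  by rewrite andbT (le_trans dx).
Qed.

Lemma nonvalid_small (R : realType) (f : Defs.form) (v : nat -> R) (d : R) :
  0 < d -> valuation v -> Defs.eval v f != 1 ->
  exists2 w : nat -> R, valuation w & Defs.eval w f < d.
Proof.
move=> d0 vv fn1.
(* The bound d/2 gives e < d, and the bound 1/2 gives the e < 1 that [squeeze_mono] asks for. *)
pose e := Num.min (d / 2) (2^-1 : R).
have e0 : 0 < e by rewrite lt_min; apply/andP; split; lra.
have e1 : e < 1 by rewrite gt_min; apply/orP; right; lra.
have ed : e < d by rewrite gt_min; apply/orP; left; lra.
have h0 : squeeze e 0 = 0 by rewrite /squeeze eq_sym oner_eq0 mul0r.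
have h1 : squeeze e 1 = 1 by rewrite /squeeze eqxx.
exists (squeeze e \o v).
  move=> p; have := vv p; rewrite /= !in_itv /= => /andP[p0 p1].
  rewrite /squeeze; case: ifP => _; first by rewrite ler01 lexx.
  by apply/andP; split; nra.
rewrite eval_comp //; last by apply: squeeze_mono; rewrite e0.
(* The value t of [f] under [v] lies in [0,1], so t * e <= e < d. *)
by rewrite /squeeze (negbTE fn1); have /andP[] := eval_itv _ _ f vv; nra.
Qed.

(** If [v p] is 0, the second disjunct has value 1; otherwise the first is already positive. *)
Lemma excluded_middle_gt0 (R : realType) (v : nat -> R) (p : nat) :
  valuation v -> 0 < Defs.eval v (Or (Var p) (Neg (Var p))).
Proof.
move=> vv /=; rewrite lt_max; case: (eqVneq (v p) 0) => [_|pn0].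
  by rewrite ltr01 orbT.
by have := vv p; rewrite /= in_itv /= lt_neqAle eq_sym pn0 => /andP[->].
Qed.

Lemma excluded_middle_nonvalid (R : realType) (p : nat) :
  ~ biG_valid R (Or (Var p) (Neg (Var p))).
Proof.
move=> /(_ (fun=> 2^-1)) /= H.
have : valuation (fun=> 2^-1 : R).
  by move=> q; rewrite /= in_itv /=; apply/andP; split; lra.
by move=> /H; rewrite invr_eq0 pnatr_eq0 /= max_l; lra.
Qed.

Theorem theorem1 (R : realType) (D : set R) (hD : is_filter D) :
  validity_stable D <->
  exists D' : set R, point_generated D' /\ D `<=` D'.
Proof.
split=> [stable|[D' [[_ [d [d0 ->]]] sD]] f].
  apply: contrapT => noD'; apply: (@excluded_middle_nonvalid R 0%N).
  apply/stable => v vv.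
  have y0 := excluded_middle_gt0 _ _ 0%N vv.
  have /andP[_ y1] := eval_itv _ _ (Or (Var 0) (Neg (Var 0))) vv.
  move: (Defs.eval _ _) y0 y1 => y y0 y1.
  apply: contrapT => nDy; apply: noD'.
  (* Since [D] is upward closed and misses y, it has no element below y, so it lies inside [y,1];
     this is point-generated because y > 0. *)
  exists `[y, 1]%classic; split; first exact: point_generated_itv.
  case: hD => _ [sD _] _ up x Dx.
  have /= := sD _ Dx; rewrite !in_itv /= => /andP[_ ->]; rewrite andbT leNgt.
  by apply/negP => xy; apply: nDy; exact: up Dx (ltW xy) y1.
split=> [Df v vv|valid v vv]; last by rewrite valid //; exact: filter1.
apply/eqP; apply: contrapT => /negP fn1.
(* A valuation refuting [f] yields another one whose value falls below d, hence outside [D]. *)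
have [w ww wd] := nonvalid_small _ _ _ _ d0 vv fn1.
by have /= := sD _ (Df _ ww); rewrite in_itv /= leNgt wd.
Qed.
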